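(* Every $\mathrm{sum}$-DHN that uses dyadic rational piecewise-linear activation and dyadic rational coefficients is equivalent to an HML+C formula; that is, for every such DHN $\mathcal N$ over a schema $S$ there is an HML+C formula $\varphi(x)$ over $S$ such that for all pointed $S$-databases $D^v$, $\mathcal N$ accepts $D^v$ if and only if $D\models\varphi(v)$.
   Context: Databases. A schema $S$ is a finite set of relation symbols $R$ with arities $\mathrm{ar}(R)\ge 0$. An $S$-database $D$ is a finite set of facts $R(\bar v)$, $R\in S$, $\bar v$ an $\mathrm{ar}(R)$-tuple of values from a fixed countably infinite set; $\mathrm{adom}(D)$ is the set of values of $D$. A pointed database $D^v$ is a database $D$ with a distinguished $v\in\mathrm{adom}(D)$. In a pattern database $F$, $\mathrm{adom}(F)$ may also contain values that occur in no fact. $\mathrm{Hom}(F^w,D^u)$ is the set of maps $h:\mathrm{adom}(F)\to\mathrm{adom}(D)$ with $h(w)=u$ such that $R(\bar v)\in F$ implies $R(h(\bar v))\in D$. sum-DHNs. A homomorphism query with sum aggregation, of input dimension $d\ge 0$ and output dimension $d'>0$, is given by a pointed pattern database $F^w$ and a labeling $\mu$ assigning to each $v\in\mathrm{adom}(F)$ a transformation function $\mu_v:\mathbb R^d\to\mathbb R^{d'}$. On $D^u$ with embedding $\lambda:\mathrm{adom}(D)\to\mathbb R^d$ its result is $\sum_{h\in\mathrm{Hom}(F^w,D^u)}\prod_{v\in\mathrm{adom}(F)}\mu_v(\lambda(h(v)))$ (component-wise). A layer consists of a finite sequence of such queries of the same input dimension, with output dimensions $d_1,\dots,d_m$, and a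 combination function $\mathrm{com}:\mathbb R^{d_1}\times\dots\times\mathbb R^{d_m}\to\mathbb R^{d'}$; it maps $\lambda$ to the embedding sending $u$ to $\mathrm{com}$ applied to the results of the queries on $(D^u,\lambda)$. A sum-DHN (deep homomorphism network with sum aggregation) over $S$ is a sequence $(\mathcal L_1,\dots,\mathcal L_k,\mathrm{cls})$ of layers with matching dimensions, where the input dimension of $\mathcal L_1$ is $0$, together with a classification function $\mathrm{cls}:\mathbb R^{d'}\to\{0,1\}$, $d'$ being the output dimension of $\mathcal L_k$. Starting from the embedding that assigns the empty vector to every value, the layers are applied in order to obtain $\lambda^k$; the DHN accepts $D^v$ iff $\mathrm{cls}(\lambda^k(v))=1$. Dyadic networks. A dyadic rational is a number $z/2^s$ with $z\in\mathbb Z$, $s\in\mathbb N$. A feed-forward neural network (FNN) is a composition of maps $\bar v\mapsto\sigma(\bar vA+\bar b)$ with weight matrix $A$, bias vector $\bar b$ and activation function $\sigma:\mathbb R\to\mathbb R$ applied component-wise. All activation functions are assumed to be Lipschitz continuous. An FNN uses dyadic rational piecewise-linear activation if its activation functions are piecewise linear (with finitely many pieces) and all their slopes, intercepts and thresholds are dyadic rationals; it uses dyadic rational coefficients if all its weights and biases are dyadic rationals. A DHN uses dyadic rational piecewise-linear activation if every transformation, combination and classification function in it is represented by an FNN that does; it uses dyadic rational coefficients if every FNN in it does. HML+C. A two-sorted logic with individual variables ($x,y$, ranging over $\mathrm{adom}(D)$) and number variables ($n,m$, ranging over $\mathbb N$). Numerical terms and individual formulas are defined by mutual recursion: $t(x,\bar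 n)::=c\mid n\mid t+t\mid t\cdot t\mid\#(\bar y,m_1<t_1,\dots,m_k<t_k).\psi(x,\bar y,\bar n,m_1,\dots,m_k)$, $\varphi(x,\bar n)::=\neg\varphi(x,\bar n)\mid\varphi(x,\bar n)\vee\varphi(x,\bar n)\mid t(x,\bar n)\le t'(x,\bar n)$, where $c$ ranges over $\mathbb N$; each bounding term $t_i$ may use $x$, all variables from $\bar y$, the variables $m_1,\dots,m_{i-1}$, and all variables in $\bar n$; and $\psi$ is a conjunction of relational atoms $R(\bar z)$, where $\bar z$ contains only $x$ and variables from $\bar y$, and of formulas $\chi(z,\bar n,m_1,\dots,m_k)$ with one free individual variable $z$, where $z$ is $x$ or a variable from $\bar y$. The semantics is the standard one of multi-sorted first-order logic, except for counting terms: under an assignment $\alpha$, $\#(\bar y,m_1<t_1,\dots,m_k<t_k).\psi$ evaluates to the number of tuples $\bar a\bar b$ with $\bar a\in\mathrm{adom}(D)^{|\bar y|}$ and $\bar b=(b_1,\dots,b_k)\in\mathbb N^k$ such that for $1\le i\le k$, $b_i$ is smaller than the value of $t_i$ under $\alpha[\bar y/\bar a][m_1/b_1]\cdots[m_{i-1}/b_{i-1}]$, and $\psi$ is true under $\alpha[\bar y/\bar a][\bar m/\bar b]$, where $\bar m=(m_1,\dots,m_k)$. *)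

(* Defs.v *)
From mathcomp Require Import all_boot all_order all_algebra finmap.
From mathcomp Require Import all_classical all_reals normedtype.
Set Implicit Arguments.
Unset Strict Implicit.
Unset Printing Implicit Defensive.
Import Order.TTheory GRing.Theory Num.Theory numFieldNormedType.Exports.
Local Open Scope fset_scope.
Local Open Scope ring_scope.

Record schema := Schema { relation :> finType; ar : relation -> nat }.

(* The fixed countably infinite set of values. *)
Definition value : countType := nat.

Definition fact (S : schema) (V : choiceType) : choiceType :=
  {r : S & (ar r).-tuple V}.

Definition map_fact (S : schema) (V W : choiceType) (h : V -> W) (f : fact S V) :
  fact S W := existT _ (tag f) (map_tuple h (tagged f)).

Definition database (S : schema) : Type := {fset fact S value}.

Definition adom (S : schema) (D : database S) : {fset value} :=
  [fset x in flatten [seq tval (tagged f) | f <- D]].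

(* The facts range over the finite type [pat_adom], which may have elements
   that occur in no fact. *)
Record pattern (S : schema) := Pattern {
  pat_adom : {fset value};
  pat_facts : {fset fact S pat_adom};
  pat_point : pat_adom }.

Definition is_hom (S : schema) (F : pattern S) (D : database S) (u : adom D)
    (h : {ffun pat_adom F -> adom D}) : bool :=
  (h (pat_point F) == u) &&
  [forall f : pat_facts F, map_fact (fun v => val (h v)) (val f) \in D].

Section Networks.
Variable R : realType.

Record activation := Activation {
  act_fun :> R -> R;
  act_lipschitz : exists k : R, k.-lipschitz (act_fun : R^o -> R^o) }.

(* Nonempty compositions of maps v |-> s (v A + b), from R^d to R^e. *)
Inductive fnn (e : nat) : nat -> Type :=
| FnnLast d (A : 'M[R]_(d, e)) (b : 'rV[R]_e) (s : activation) : fnn e d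
| FnnCons d c (A : 'M[R]_(d, c)) (b : 'rV[R]_c) (s : activation)
    (f : fnn e c) : fnn e d.

Fixpoint fnn_eval e d (f : fnn e d) : 'rV[R]_d -> 'rV[R]_e :=
  match f with
  | FnnLast _ A b s => fun v => map_mx s (v *m A + b)
  | FnnCons _ _ A b s f' => fun v => fnn_eval f' (map_mx s (v *m A + b))
  end.

Definition is_dyadic (x : R) : Prop :=
  exists (z : int) (s : nat), x = z%:~R / 2 ^+ s.

(* On the piece between two consecutive thresholds, or beyond the extreme ones,
   the map is x |-> a x + b. A threshold is assigned to the piece on its right,
   which is immaterial for continuous maps. *)
Definition dyadic_piecewise_linear (s : R -> R) : Prop :=
  exists (t : seq R) (p : seq (R * R)),
    [/\ sorted <%R t, size p = (size t).+1,
        (forall c, c \in t -> is_dyadic c),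
        (forall ab, ab \in p -> is_dyadic ab.1 /\ is_dyadic ab.2) &
        forall x, let ab := nth (0, 0) p (count (fun c => c <= x) t) in
          s x = ab.1 * x + ab.2].

Fixpoint dyadic_pl_activation e d (f : fnn e d) : Prop :=
  match f with
  | FnnLast _ _ _ s => dyadic_piecewise_linear s
  | FnnCons _ _ _ _ s f' =>
      dyadic_piecewise_linear s /\ dyadic_pl_activation f'
  end.

Definition dyadic_mx m n (A : 'M[R]_(m, n)) : Prop :=
  forall i j, is_dyadic (A i j).

Fixpoint dyadic_coefficients e d (f : fnn e d) : Prop :=
  match f with
  | FnnLast _ A b _ => dyadic_mx A /\ dyadic_mx b
  | FnnCons _ _ A b _ f' =>
      [/\ dyadic_mx A, dyadic_mx b & dyadic_coefficients f']
  end.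

Variable S : schema.

Record query (d d' : nat) := Query {
  query_out_gt0 : (0 < d')%N;
  query_pat : pattern S;
  query_mu : pat_adom query_pat -> 'rV[R]_d -> 'rV[R]_d' }.

Definition query_eval d d' (q : query d d') (D : database S)
    (lam : adom D -> 'rV[R]_d) (u : adom D) : 'rV[R]_d' :=
  \row_(j < d')
    \sum_(h : {ffun pat_adom (query_pat q) -> adom D} | is_hom u h)
      \prod_(v : pat_adom (query_pat q)) query_mu v (lam (h v)) 0 j.

Record layer (d d' : nat) := Layer {
  lsize : nat;
  ldim : 'I_lsize -> nat;
  lquery : forall i, query d (ldim i);
  lcom : (forall i, 'rV[R]_(ldim i)) -> 'rV[R]_d' }.
Arguments lquery {d d'} l i.
Arguments lcom {d d'} l y.

Definition layer_eval d d' (L : layer d d') (D : database S)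
    (lam : adom D -> 'rV[R]_d) (u : adom D) : 'rV[R]_d' :=
  lcom L (fun i => query_eval (lquery L i) lam u).

Inductive layers (e : nat) : nat -> Type :=
| LayersLast d (L : layer d e) : layers e d
| LayersCons d c (L : layer d c) (Ls : layers e c) : layers e d.

Fixpoint layers_eval e d (Ls : layers e d) (D : database S) :
    (adom D -> 'rV[R]_d) -> adom D -> 'rV[R]_e :=
  match Ls with
  | LayersLast _ L => fun lam => layer_eval L lam
  | LayersCons _ _ L Ls' => fun lam => layers_eval Ls' (layer_eval L lam)
  end.

Record sum_dhn := SumDHN {
  dhn_dim : nat;
  dhn_layers : layers dhn_dim 0;
  dhn_cls : 'rV[R]_dhn_dim -> bool }.

Definition dhn_accepts (N : sum_dhn) (D : database S) (v : adom D) : bool :=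
  dhn_cls (layers_eval (dhn_layers N) (fun _ => 0 : 'rV[R]_0) v).

Definition represents d d' (f : fnn d' d) (g : 'rV[R]_d -> 'rV[R]_d') : Prop :=
  forall x, g x = fnn_eval f x.

(* The arguments of [com] are concatenated into a single row vector. *)
Definition represents_com m (n : 'I_m -> nat) d'
    (f : fnn d' (\sum_i n i)) (com : (forall i, 'rV[R]_(n i)) -> 'rV[R]_d') :
    Prop :=
  forall y, com y = fnn_eval f (\mxrow_(i < m) y i).

Definition dyadic_bound (b : itv_bound R) : Prop :=
  if b is BSide _ x then is_dyadic x else True.

(* FNNs are continuous, so an FNN with values exactly in {0, 1} is constant.
   The real output of the network is therefore turned into a class by testing
   membership in an interval with dyadic or infinite endpoints. This includes
   the tests "> 0", ">= 1/2" and "= 1", the last of which covers networks whose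
   output is literally 0 or 1. *)
Definition represents_cls d (f : fnn 1 d) (cls : 'rV[R]_d -> bool) : Prop :=
  exists l r : itv_bound R, [/\ dyadic_bound l, dyadic_bound r &
    forall x, cls x = (fnn_eval f x 0 0 \in Interval l r)].

Section Represented.
Variable P : forall e d, fnn e d -> Prop.

Definition layer_represented d d' (L : layer d d') : Prop :=
  (forall i v, exists2 f, P f & represents f (query_mu (q := lquery L i) v)) /\
  (exists2 f, P f & represents_com f (lcom L)).

Fixpoint layers_represented e d (Ls : layers e d) : Prop :=
  match Ls with
  | LayersLast _ L => layer_represented L
  | LayersCons _ _ L Ls' => layer_represented L /\ layers_represented Ls'
  end.

Definition dhn_represented (N : sum_dhn) : Prop :=
  layers_represented (dhn_layers N) /\
  (exists2 f, P f & represents_cls f (dhn_cls (s := N))).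

End Represented.

(* One and the same choice of representing FNNs must meet both conditions. *)
Definition dyadic_dhn (N : sum_dhn) : Prop :=
  dhn_represented
    (fun e d (f : fnn e d) => dyadic_pl_activation f /\ dyadic_coefficients f)
    N.

End Networks.

(* HML+C in well-scoped de Bruijn style. In [term l n], individual variables
   range over 'I_l and number variables over 'I_n; [formula n] has a single
   individual variable and is the sort of formulas phi(x, n_1, ..., n_n).
   [TCount z k b psi] is the counting term #(y_1 ... y_k, b).psi whose variable
   x is z; inside it the individual variables are 0 for x and i for y_i, and
   these are all available to the bounding terms and to psi.
   [bounds l n n'] is a list m_1 < t_1, ..., m_(n'-n) < t_(n'-n), each t_i having
   access to m_1, ..., m_(i-1); a newly bound number variable has index 0 and
   the older ones are shifted by one. *)
Inductive term (S : schema) : nat -> nat -> Type :=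
| TConst l n (c : nat) : term S l n
| TVar l n (i : 'I_n) : term S l n
| TAdd l n (t1 t2 : term S l n) : term S l n
| TMul l n (t1 t2 : term S l n) : term S l n
| TCount l n (z : 'I_l) k n' (b : bounds S k.+1 n n') (psi : body S k.+1 n') :
    term S l n
with bounds (S : schema) : nat -> nat -> nat -> Type :=
| BNil l n : bounds S l n n
| BCons l n n' (t : term S l n) (b : bounds S l n.+1 n') : bounds S l n n'
with body (S : schema) : nat -> nat -> Type :=
| BAtom l n (r : S) (z : (ar r).-tuple 'I_l) : body S l n
| BFormula l n (z : 'I_l) (chi : formula S n) : body S l n
| BAnd l n (psi1 psi2 : body S l n) : body S l n
with formula (S : schema) : nat -> Type :=
| FNot n (phi : formula S n) : formula S n
| FOr n (phi1 phi2 : formula S n) : formula S n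
| FLe n (t1 t2 : term S 1 n) : formula S n.

Definition env_cons (T : Type) k (x : T) (e : 'I_k -> T) (i : 'I_k.+1) : T :=
  oapp e x (unlift ord0 i).

Section Semantics.
Variables (S : schema) (D : database S).

(* [bounds_count b e a P] is the number of tuples b_1 ... b_k within the
   bounds [b] for which the extension of [a] by them satisfies [P]. *)
Fixpoint term_eval l n (t : term S l n) :
    ('I_l -> adom D) -> ('I_n -> nat) -> nat :=
  match t with
  | TConst _ _ c => fun _ _ => c
  | TVar _ _ i => fun _ a => a i
  | TAdd _ _ t1 t2 => fun e a => (term_eval t1 e a + term_eval t2 e a)%N
  | TMul _ _ t1 t2 => fun e a => (term_eval t1 e a * term_eval t2 e a)%N
  | TCount _ _ z k _ b psi => fun e a =>
      (\sum_(y : {ffun 'I_k -> adom D})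
         let e' := env_cons (e z) y in
         bounds_count b e' a (body_eval psi e'))%N
  end
with bounds_count l n n' (b : bounds S l n n') :
    ('I_l -> adom D) -> ('I_n -> nat) -> (('I_n' -> nat) -> bool) -> nat :=
  match b with
  | BNil _ _ => fun _ a P => nat_of_bool (P a)
  | BCons _ _ _ t b' => fun e a P =>
      (\sum_(m < term_eval t e a) bounds_count b' e (env_cons (m : nat) a) P)%N
  end
with body_eval l n (psi : body S l n) :
    ('I_l -> adom D) -> ('I_n -> nat) -> bool :=
  match psi with
  | BAtom _ _ r z => fun e _ =>
      (existT _ r (map_tuple (fun i => val (e i)) z) : fact S value) \in D
  | BFormula _ _ z chi => fun e a => formula_eval chi (e z) a
  | BAnd _ _ psi1 psi2 => fun e a => body_eval psi1 e a && body_eval psi2 e a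
  end
with formula_eval n (phi : formula S n) : adom D -> ('I_n -> nat) -> bool :=
  match phi with
  | FNot _ phi' => fun u a => ~~ formula_eval phi' u a
  | FOr _ phi1 phi2 => fun u a => formula_eval phi1 u a || formula_eval phi2 u a
  | FLe _ t1 t2 => fun u a =>
      (term_eval t1 (fun _ => u) a <= term_eval t2 (fun _ => u) a)%N
  end.

(* The formula has no free number variables, so the assignment is empty. *)
Definition models (phi : formula S 0) (v : adom D) : bool :=
  formula_eval phi v (fun _ => 0%N).

End Semantics.

(* Main.v *)
Require Import Defs.
From mathcomp Require Import all_boot finmap reals.
From mathcomp Require Import all_order all_algebra boolp interval ring.

(** The coefficients of the network are dyadic, hence there is one exponent [s],
    depending on the network only, such that all embeddings take values in
    [2^-s Z]. Each coordinate of each embedding is therefore [(p - q) / 2^s]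
    for two HML+C terms [p] and [q]. Affine maps and case distinctions on
    thresholds preserve this form. For a homomorphism query, expanding the
    product of the differences [p_v - q_v] leaves signed sums of
    [\sum_h \prod_v t_v (h v)] with [t_v] a term, and this sum is the counting
    term [#(y, m_v < t_v(y_v)).psi], where [psi] lists the facts
    of the pattern. *)

Set Implicit Arguments.
Unset Strict Implicit.
Unset Printing Implicit Defensive.
Import Order.TTheory GRing.Theory Num.Theory.

Section Definability.
Variable S : schema.

(* Terms and formulas that make sense in every variable context; this replaces
   substitution and weakening. *)
Definition nat_definable (f : forall D : database S, adom D -> nat) : Prop :=
  exists t : forall l n, 'I_l -> term S l n,
    forall D l n (i : 'I_l) (e : 'I_l -> adom D) (a : 'I_n -> nat),
      term_eval (t l n i) e a = f D (e i).

Definition bool_definable (P : forall D : database S, adom D -> bool) : Prop :=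
  exists phi : forall n, formula S n,
    forall D n (u : adom D) (a : 'I_n -> nat),
      formula_eval (phi n) u a = P D u.

(** * Closure of definable numbers and properties under arithmetic and logic *)

Lemma nat_definable_const c : nat_definable (fun _ _ => c).
Proof. by exists (fun l n _ => TConst S l n c). Qed.

Lemma nat_definableD f g : nat_definable f -> nat_definable g ->
  nat_definable (fun D u => f D u + g D u).
Proof.
move=> [t Ht] [t' Ht']; exists (fun l n i => TAdd (t l n i) (t' l n i)).
by move=> D l n i e a /=; rewrite Ht Ht'.
Qed.

Lemma nat_definableM f g : nat_definable f -> nat_definable g ->
  nat_definable (fun D u => f D u * g D u).
Proof.
move=> [t Ht] [t' Ht']; exists (fun l n i => TMul (t l n i) (t' l n i)).
by move=> D l n i e a /=; rewrite Ht Ht'.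
Qed.

Lemma bool_definableN P : bool_definable P ->
  bool_definable (fun D u => ~~ P D u).
Proof.
move=> [phi Hphi]; exists (fun n => FNot (phi n)).
by move=> D n u a /=; rewrite Hphi.
Qed.

Lemma bool_definable_or P Q : bool_definable P -> bool_definable Q ->
  bool_definable (fun D u => P D u || Q D u).
Proof.
move=> [phi Hphi] [psi Hpsi]; exists (fun n => FOr (phi n) (psi n)).
by move=> D n u a /=; rewrite Hphi Hpsi.
Qed.

Lemma bool_definable_and P Q : bool_definable P -> bool_definable Q ->
  bool_definable (fun D u => P D u && Q D u).
Proof.
move=> /bool_definableN HP /bool_definableN HQ.
have [phi Hphi] := bool_definableN (bool_definable_or HP HQ).
by exists phi => D n u a; rewrite Hphi negb_or !negbK.
Qed.

Lemma bool_definable_leq f g : nat_definable f -> nat_definable g ->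
  bool_definable (fun D u => f D u <= g D u).
Proof.
move=> [t Ht] [t' Ht']; exists (fun n => FLe (t 1 n ord0) (t' 1 n ord0)).
by move=> D n u a /=; rewrite Ht Ht'.
Qed.

Lemma bool_definable_const b : bool_definable (fun _ _ => b).
Proof.
(* The inequality [~~ b <= 0] between naturals holds exactly when [b] is true. *)
have [phi Hphi] :=
  bool_definable_leq (nat_definable_const (~~ b)) (nat_definable_const 0).
by exists phi => D n u a; rewrite Hphi; case: b {Hphi}.
Qed.

(** A counting term that binds no variable counts at most the empty tuple, so its value is the truth
    value of its body. *)
Lemma nat_definable_indicator P : bool_definable P ->
  nat_definable (fun D u => nat_of_bool (P D u)).
Proof.
move=> [phi Hphi].
exists (fun l n i => TCount i (BNil S 1 n) (BFormula ord0 (phi n))).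
move=> D l n i e a /=.
under eq_bigr => y _ do rewrite Hphi /env_cons unlift_none /=.
by rewrite sum_nat_const card_ffun card_ord expn0 mul1n.
Qed.

(** * Counting terms and sums over homomorphisms *)

Fixpoint bounds_end T (s : seq T) (n : nat) : nat :=
  if s is _ :: s' then bounds_end s' n.+1 else n.

(** [bounds_end] increments its argument [n], as [BCons] does, so that the [BCons] branch typechecks
    by conversion; [size ts + n] would require a cast. *)
Fixpoint bounds_of_seq l (ts : seq (forall n, term S l n)) (n : nat) :
    bounds S l n (bounds_end ts n) :=
  match ts with
  | [::] => BNil S l n
  | t :: ts' => BCons (t n) (bounds_of_seq ts' n.+1)
  end.

(** No bound depends on the number variables bound before it, and the condition [P] does not depend
    on the assignment, so each bound contributes an independent factor. *)
Lemma bounds_count_seq (D : database S) l (e : 'I_l -> adom D) c (I : Type)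
    (r : seq I) (t : I -> forall n, term S l n) (f : I -> nat) :
  (forall i n (a : 'I_n -> nat), term_eval (t i n) e a = f i) ->
  forall n (a : 'I_n -> nat) P, (forall a', P a' = c) ->
  bounds_count (bounds_of_seq (map t r) n) e a P = c * \prod_(i <- r) f i.
Proof.
move=> Hf; elim: r => [|i r IH] n a P HP /=.
  by rewrite HP big_nil muln1.
under eq_bigr => m _ do rewrite IH //.
by rewrite sum_nat_const card_ord Hf big_cons mulnCA.
Qed.

Fixpoint body_of_facts l (fs : seq {r : S & (ar r).-tuple 'I_l}) (z : 'I_l) n :
    body S l n :=
  match fs with
  (* Bodies have no empty conjunction, so the trivially true formula [0 <= 0], stated at [z], ends
     the list. *)
  | [::] => BFormula z (FLe (TConst S 1 n 0) (TConst S 1 n 0))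
  | f :: fs' => BAnd (BAtom n (tagged f)) (body_of_facts fs' z n)
  end.

Lemma body_eval_facts (D : database S) l fs z n (e : 'I_l -> adom D)
    (a : 'I_n -> nat) :
  body_eval (body_of_facts fs z n) e a =
  all (fun f => (existT _ (tag f) (map_tuple (fun i => val (e i)) (tagged f))
                 : fact S value) \in D) fs.
Proof. by elim: fs => [|f fs IH] //=; rewrite IH. Qed.

Section HomSum.
Variable F : pattern S.

Let nonpoint : finType := {v : pat_adom F | v != pat_point F}.

(* There is no equality atom, so the distinguished value must be represented by
   the variable [x] itself. *)
Definition pat_var (v : pat_adom F) : 'I_#|nonpoint|.+1 :=
  oapp (fun w : nonpoint => lift ord0 (enum_rank w)) ord0 (insub v).

Definition hom_of_env (D : database S) (e : 'I_#|nonpoint|.+1 -> adom D) :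
    {ffun pat_adom F -> adom D} := [ffun v => e (pat_var v)].

Definition env_of_hom (D : database S) (h : {ffun pat_adom F -> adom D}) :
    {ffun 'I_#|nonpoint| -> adom D} := [ffun i => h (val (enum_val i))].

Lemma env_cons0 T k (x : T) (e : 'I_k -> T) : env_cons x e ord0 = x.
Proof. by rewrite /env_cons unlift_none. Qed.

Lemma env_consS T k (x : T) (e : 'I_k -> T) i :
  env_cons x e (lift ord0 i) = e i.
Proof. by rewrite /env_cons liftK. Qed.

Lemma pat_var_point : pat_var (pat_point F) = ord0.
Proof. by rewrite /pat_var insubF // eqxx. Qed.

Lemma pat_var_nonpoint (w : nonpoint) :
  pat_var (val w) = lift ord0 (enum_rank w).
Proof. by rewrite /pat_var valK. Qed.

Lemma hom_of_envK (D : database S) (u : adom D)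
    (h : {ffun pat_adom F -> adom D}) :
  h (pat_point F) = u -> hom_of_env (env_cons u (env_of_hom h)) = h.
Proof.
move=> hu; apply/ffunP => v; rewrite ffunE.
have [->|vw] := eqVneq v (pat_point F); first by rewrite pat_var_point env_cons0.
by rewrite -[v]/(val (Sub v vw : nonpoint)) pat_var_nonpoint env_consS ffunE
           enum_rankK.
Qed.

Lemma env_of_homK (D : database S) (u : adom D)
    (y : {ffun 'I_#|nonpoint| -> adom D}) :
  env_of_hom (hom_of_env (env_cons u y)) = y.
Proof.
apply/ffunP => i; rewrite !ffunE pat_var_nonpoint env_consS.
by rewrite enum_valK.
Qed.

Definition pat_atoms : seq {r : S & (ar r).-tuple 'I_#|nonpoint|.+1} :=
  [seq existT _ (tag f) (map_tuple pat_var (tagged f)) | f <- pat_facts F].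

(** Atoms suffice: the condition on the distinguished value is automatic, because [pat_var] sends it
    to variable 0. *)
Lemma pat_atomsP (D : database S) (e : 'I_#|nonpoint|.+1 -> adom D) :
  all (fun f => (existT _ (tag f) (map_tuple (fun i => val (e i)) (tagged f))
                 : fact S value) \in D) pat_atoms =
  is_hom (e ord0) (hom_of_env e).
Proof.
rewrite /is_hom ffunE pat_var_point eqxx /= /pat_atoms all_map.
have E f : map_fact (fun v => val (hom_of_env e v)) f =
    existT _ (tag f) (map_tuple (fun i => val (e i))
                        (map_tuple pat_var (tagged f))).
  rewrite /map_fact; congr (existT _ _ _); apply: val_inj => /=.
  by rewrite -map_comp; apply: eq_map => v /=; rewrite ffunE.
apply/allP/forallP => [H f|H f Hf]; first by rewrite E; apply: H; apply: valP.
by have := H [` Hf]%fset; rewrite E.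
Qed.

Lemma nat_definable_hom_sum
    (t : pat_adom F -> forall D : database S, adom D -> nat) :
  (forall v, nat_definable (t v)) ->
  nat_definable (fun D u =>
    \sum_(h : {ffun pat_adom F -> adom D} | is_hom u h)
      \prod_(v : pat_adom F) t v D (h v)).
Proof.
move=> /choice[tm Htm].
pose ts := [seq (fun n => tm v #|nonpoint|.+1 n (pat_var v))
           | v <- index_enum (pat_adom F)].
exists (fun l n i => TCount i (bounds_of_seq ts n)
                       (body_of_facts pat_atoms ord0 _)).
move=> D l n i e a /=.
(* Assignments of the [y] variables correspond to the maps that send the distinguished value to
   [e i]. *)
rewrite (reindex_onto (fun y : {ffun 'I_#|nonpoint| -> adom D} =>
           hom_of_env (env_cons (e i) y)) (@env_of_hom D)) /=; last first.
  by move=> h /andP[/eqP hu _]; apply: hom_of_envK.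
rewrite [RHS]big_mkcond /=; apply: eq_bigr => y _.
rewrite env_of_homK eqxx andbT.
(* For fixed [y] the body only tests whether the map is a homomorphism; other maps contribute 0. *)
rewrite (bounds_count_seq _
   (c := is_hom (e i) (hom_of_env (env_cons (e i) y)))
   (f := fun v => t v D (hom_of_env (env_cons (e i) y) v))).
- by case: is_hom; rewrite ?mul1n ?mul0n.
- by move=> v n' a'; rewrite Htm ffunE.
- by move=> a'; rewrite body_eval_facts pat_atomsP env_cons0.
Qed.

End HomSum.

(** * Real-valued functions with definable dyadic values *)

Local Open Scope ring_scope.
Variable R : realType.

Definition dyadic_definable (g : forall D : database S, adom D -> R) : Prop :=
  exists (s : nat) (p q : forall D : database S, adom D -> nat),
    [/\ nat_definable p, nat_definable q &
        forall D u, g D u = ((p D u)%:R - (q D u)%:R) / 2 ^+ s].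

Lemma expr2_neq0 s : 2 ^+ s != 0 :> R.
Proof. by rewrite expf_neq0 ?pnatr_eq0. Qed.

Lemma eq_dyadic_definable g g' : (forall D u, g D u = g' D u) ->
  dyadic_definable g -> dyadic_definable g'.
Proof.
move=> E [s [p [q [Hp Hq H]]]]; exists s, p, q.
by split=> // D u; rewrite -E.
Qed.

Lemma dyadic_definable_nat f :
  nat_definable f -> dyadic_definable (fun D u => (f D u)%:R).
Proof.
move=> Hf; exists 0, f, (fun _ _ => 0); split=> //.
  exact: nat_definable_const.
by move=> D u; rewrite subr0 expr0 divr1.
Qed.

Lemma dyadic_definable_const c :
  is_dyadic c -> dyadic_definable (fun _ _ => c).
Proof.
move=> [z [s ->]]; case: z => m.
  exists s, (fun _ _ => m), (fun _ _ => 0); split; try exact: nat_definable_const.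
  by move=> D u; rewrite subr0.
exists s, (fun _ _ => 0), (fun _ _ => m.+1).
split; try exact: nat_definable_const.
by move=> D u; rewrite sub0r NegzE mulrNz.
Qed.

Lemma dyadic_definableD g g' : dyadic_definable g -> dyadic_definable g' ->
  dyadic_definable (fun D u => g D u + g' D u).
Proof.
move=> [s [p [q [Hp Hq H]]]] [s' [p' [q' [Hp' Hq' H']]]].
(* Both fractions are brought to the denominator [2 ^+ (s + s')]. *)
exists (s + s')%N, (fun D u => p D u * 2 ^ s' + p' D u * 2 ^ s)%N,
  (fun D u => q D u * 2 ^ s' + q' D u * 2 ^ s)%N.
split; try by apply: nat_definableD; apply: nat_definableM => //;
  apply: nat_definable_const.
move=> D u; rewrite H H' !natrD !natrM !natrX exprD.
by field; rewrite !expr2_neq0.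
Qed.

Lemma dyadic_definableM g g' : dyadic_definable g -> dyadic_definable g' ->
  dyadic_definable (fun D u => g D u * g' D u).
Proof.
move=> [s [p [q [Hp Hq H]]]] [s' [p' [q' [Hp' Hq' H']]]].
(* The product [(p - q) * (p' - q')] is expanded and its terms are grouped by sign. *)
exists (s + s')%N, (fun D u => p D u * p' D u + q D u * q' D u)%N,
  (fun D u => p D u * q' D u + q D u * p' D u)%N.
split; try by apply: nat_definableD; apply: nat_definableM.
move=> D u; rewrite H H' !natrD !natrM exprD.
by field; rewrite !expr2_neq0.
Qed.

Lemma dyadic_definableN g : dyadic_definable g ->
  dyadic_definable (fun D u => - g D u).
Proof.
move=> [s [p [q [Hp Hq H]]]]; exists s, q, p; split=> // D u.
by rewrite H -mulNr opprB.
Qed.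

Lemma dyadic_definable_sum (I : Type) (r : seq I) g :
  (forall i, dyadic_definable (g i)) ->
  dyadic_definable (fun D u => \sum_(i <- r) g i D u).
Proof.
move=> Hg; elim: r => [|i r IH].
  apply: eq_dyadic_definable (dyadic_definable_nat (nat_definable_const 0)).
  by move=> D u; rewrite big_nil.
apply: eq_dyadic_definable (dyadic_definableD (Hg i) IH).
by move=> D u; rewrite big_cons.
Qed.

(** A case distinction is the sum of both branches, weighted by the indicators of [P] and of its
    negation. *)
Lemma dyadic_definable_if P g g' : bool_definable P ->
  dyadic_definable g -> dyadic_definable g' ->
  dyadic_definable (fun D u => if P D u then g D u else g' D u).
Proof.
move=> HP Hg Hg'.
have HT := dyadic_definable_nat (nat_definable_indicator HP).
have HF := dyadic_definable_nat (nat_definable_indicator (bool_definableN HP)).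
apply: eq_dyadic_definable (dyadic_definableD (dyadic_definableM HT Hg)
                              (dyadic_definableM HF Hg')) => D u /=.
by case: (P D u); rewrite ?mul1r ?mul0r ?addr0 ?add0r.
Qed.

(** The difference [g' - g] has a positive denominator, so its sign is decided by comparing the two
    naturals in its numerator. *)
Lemma bool_definable_le g g' : dyadic_definable g -> dyadic_definable g' ->
  bool_definable (fun D u => g D u <= g' D u).
Proof.
move=> Hg Hg'.
have [s [p [q [Hp Hq H]]]] := dyadic_definableD Hg' (dyadic_definableN Hg).
have [phi Hphi] := bool_definable_leq Hq Hp.
exists phi => D n u a; rewrite Hphi -[RHS]subr_ge0 H.
by rewrite pmulr_lge0 ?invr_gt0 ?exprn_gt0 // subr_ge0 ler_nat.
Qed.

Lemma bool_definable_lt g g' : dyadic_definable g -> dyadic_definable g' ->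
  bool_definable (fun D u => g D u < g' D u).
Proof.
move=> Hg Hg'.
have [phi Hphi] := bool_definableN (bool_definable_le Hg' Hg).
by exists phi => D n u a; rewrite Hphi ltNge.
Qed.

Lemma bool_definable_itv g (l r : itv_bound R) :
  dyadic_definable g -> dyadic_bound l -> dyadic_bound r ->
  bool_definable (fun D u => g D u \in Interval l r).
Proof.
move=> Hg Hl Hr.
have Hle : bool_definable (fun D u => (l <= BLeft (g D u))%O).
  case: l Hl => [[] c|[]] /= => [Hc|Hc|_|_].
  - exact: bool_definable_le (dyadic_definable_const Hc) Hg.
  - exact: bool_definable_lt (dyadic_definable_const Hc) Hg.
  - exact: bool_definable_const.
  - exact: bool_definable_const.
have Hge : bool_definable (fun D u => (BRight (g D u) <= r)%O).
  case: r Hr => [[] c|[]] /= => [Hc|Hc|_|_].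
  - exact: bool_definable_lt Hg (dyadic_definable_const Hc).
  - exact: bool_definable_le Hg (dyadic_definable_const Hc).
  - exact: bool_definable_const.
  - exact: bool_definable_const.
have [phi Hphi] := bool_definable_and Hle Hge.
by exists phi => D n u a; rewrite Hphi itv_boundlr.
Qed.

(** * Piecewise-linear activations and FNNs *)

Lemma dyadic_definable_pl (s : R -> R) g : dyadic_piecewise_linear s ->
  dyadic_definable g -> dyadic_definable (fun D u => s (g D u)).
Proof.
move=> [t [p [_ _ Ht Hp Hs]]] Hg.
(* The index of the active piece is the number of thresholds passed, a sum of definable
   indicators. *)
pose k D u := count (fun c => c <= g D u) t.
have Hk : nat_definable k.
  rewrite {}/k; elim: t Ht {Hs} => [|c t IH] Ht /=.
    exact: nat_definable_const.
  apply: nat_definableD; last by apply: IH => b Hb; apply: Ht; rewrite inE Hb orbT.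
  apply: nat_definable_indicator; apply: bool_definable_le Hg.
  by apply: dyadic_definable_const; apply: Ht; rewrite mem_head.
(* The offset [m] makes the table lookup inductive in [p]: passing to the tail of [p] raises [m] by
   one. *)
suff: forall m, dyadic_definable (fun D u =>
    (nth (0, 0) p (k D u - m)).1 * g D u + (nth (0, 0) p (k D u - m)).2).
  by move=> /(_ 0); apply: eq_dyadic_definable => D u; rewrite subn0 Hs.
elim: p Hp {Hs} => [|ab p IH] Hp m.
  apply: eq_dyadic_definable (dyadic_definable_nat (nat_definable_const 0)).
  by move=> D u; rewrite nth_nil mul0r addr0.
have [Ha Hb] := Hp ab (mem_head _ _).
have Hab := dyadic_definableD (dyadic_definableM (dyadic_definable_const Ha) Hg)
              (dyadic_definable_const Hb).
have Hp' : forall ab', ab' \in p -> is_dyadic ab'.1 /\ is_dyadic ab'.2.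
  by move=> ab' H; apply: Hp; rewrite inE H orbT.
apply: eq_dyadic_definable (dyadic_definable_if
  (bool_definable_leq Hk (nat_definable_const m)) Hab (IH Hp' m.+1)) => D u /=.
(* If [k D u <= m], truncated subtraction gives index 0, the head of the table; otherwise the index
   is a successor and the lookup continues in the tail. *)
case: leqP => [|km]; first by rewrite -subn_eq0 => /eqP ->.
by rewrite subnS -[in RHS](prednK (n := (k D u - m)%N)) // subn_gt0.
Qed.

Lemma dyadic_definable_affine_map d c (A : 'M[R]_(d, c)) (b : 'rV[R]_c)
    (s : R -> R) (x : forall D : database S, adom D -> 'rV[R]_d) :
  dyadic_mx A -> dyadic_mx b -> dyadic_piecewise_linear s ->
  (forall i, dyadic_definable (fun D u => x D u 0 i)) ->
  forall j, dyadic_definable (fun D u => map_mx s (x D u *m A + b) 0 j).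
Proof.
move=> HA Hb Hs Hx j.
have Hsum := dyadic_definable_sum (index_enum 'I_d) (fun i =>
  dyadic_definableM (Hx i) (dyadic_definable_const (HA i j))).
apply: eq_dyadic_definable (dyadic_definable_pl Hs (dyadic_definableD Hsum
  (dyadic_definable_const (Hb 0 j)))) => D u.
by rewrite !mxE.
Qed.

Definition dyadic_fnn e d (f : fnn R e d) : Prop :=
  dyadic_pl_activation f /\ dyadic_coefficients f.

Lemma dyadic_definable_fnn e d (f : fnn R e d)
    (x : forall D : database S, adom D -> 'rV[R]_d) :
  dyadic_fnn f -> (forall i, dyadic_definable (fun D u => x D u 0 i)) ->
  forall j, dyadic_definable (fun D u => fnn_eval f (x D u) 0 j).
Proof.
move=> []; elim: f x => {d} [d A b s|d c A b s f IH] x /=.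
  by move=> Hs [HA Hb] Hx; apply: dyadic_definable_affine_map.
move=> [Hs Hf] [HA Hb Hf'] Hx; apply: IH => //.
exact: dyadic_definable_affine_map.
Qed.

(** * Homomorphism queries with dyadic values *)

Lemma dyadic_definable_hom_sum (F : pattern S)
    (g : pat_adom F -> forall D : database S, adom D -> R) :
  (forall v, dyadic_definable (g v)) ->
  dyadic_definable (fun D u =>
    \sum_(h : {ffun pat_adom F -> adom D} | is_hom u h)
      \prod_(v : pat_adom F) g v D (h v)).
Proof.
move=> /choice[s /choice[p /choice[q Hg]]].
(* The Boolean [b] selects one of the two naturals in the numerator; the matching sign is
   [(-1) ^+ b]. *)
pose t (v : pat_adom F) (b : bool) := if b then q v else p v.
have Ht v b : nat_definable (t v b) by case: (Hg v) => Hp Hq _; case: b.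
pose T (f : {ffun pat_adom F -> bool}) (D : database S) (u : adom D) : nat :=
  (\sum_(h : {ffun pat_adom F -> adom D} | is_hom u h)
     \prod_v t v (f v) D (h v))%N.
have HT f : nat_definable (T f).
  exact: (nat_definable_hom_sum (t := fun v => t v (f v))).
have Hsign (f : {ffun pat_adom F -> bool}) :
    is_dyadic (\prod_v (-1) ^+ f v : R).
  exists (\prod_v (-1) ^+ f v), 0; rewrite expr0 divr1 rmorph_prod /=.
  by apply: eq_bigr => v _; rewrite rmorphXn rmorphN1.
(* The common denominator does not depend on [h], hence it factors out of the sum over
   homomorphisms. *)
have Hden : is_dyadic (\prod_v (2 ^+ s v)^-1 : R).
  exists 1, (\sum_v s v)%N; rewrite mul1r prodfV; congr (_^-1).
  by rewrite expr_sum.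
have Hsum := dyadic_definable_sum (index_enum {ffun pat_adom F -> bool}) (fun f =>
  dyadic_definableM (dyadic_definable_const (Hsign f))
    (dyadic_definable_nat (HT f))).
apply: eq_dyadic_definable (dyadic_definableM Hsum (dyadic_definable_const Hden)).
move=> D u /=.
have E (h : {ffun pat_adom F -> adom D}) : \prod_v g v D (h v) =
    (\sum_(f : {ffun pat_adom F -> bool})
       (\prod_v (-1) ^+ f v) * (\prod_v t v (f v) D (h v))%N%:R) *
    \prod_v (2 ^+ s v)^-1.
  have gE v : g v D (h v) =
      (\sum_(b : bool) (-1) ^+ b * (t v b D (h v))%:R) * (2 ^+ s v)^-1.
    have [_ _ ->] := Hg v; congr (_ / _).
    by rewrite big_bool /= mulN1r mul1r addrC.
  under eq_bigr => v _ do rewrite gE.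
  (* Distributivity turns the product of two-term sums into a sum over the choice functions [f]. *)
  rewrite big_split /= bigA_distr_bigA /=; congr (_ * _).
  by apply: eq_bigr => f _; rewrite big_split natr_prod.
under [RHS]eq_bigr => h _ do rewrite E.
rewrite -mulr_suml exchange_big /=; congr (_ * _).
by apply: eq_bigr => f _; rewrite -mulr_sumr natr_sum.
Qed.

(** * Layers and whole networks *)

Lemma dyadic_definable_layer d d' (L : layer R S d d')
    (lam : forall D : database S, adom D -> 'rV[R]_d) :
  layer_represented dyadic_fnn L ->
  (forall i, dyadic_definable (fun D u => lam D u 0 i)) ->
  forall j, dyadic_definable (fun D u => layer_eval L (lam D) u 0 j).
Proof.
move=> [Hmu [f Hf Hcom]] Hlam j.
pose y (D : database S) (u : adom D) :=
  \mxrow_i query_eval (lquery (l := L) i) (lam D) u.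
apply: (@eq_dyadic_definable (fun D u => fnn_eval f (y D u) 0 j)).
  by move=> D u; rewrite /layer_eval Hcom.
apply: (dyadic_definable_fnn (x := y)) => // k.
(* Coordinate [k] of the concatenated row is component [tagnat.sig2 k] of the result of query
   [tagnat.sig1 k]. *)
pose g v D u := query_mu (q := lquery (l := L) (tagnat.sig1 k)) v (lam D u) 0 (tagnat.sig2 k).
apply: (@eq_dyadic_definable (fun D u =>
  \sum_(h : {ffun pat_adom (query_pat (lquery (l := L) (tagnat.sig1 k))) -> adom D}
       | is_hom u h) \prod_v g v D (h v))).
  by move=> D u; rewrite !mxE.
apply: dyadic_definable_hom_sum => v.
have [f' Hf' Hrep] := Hmu (tagnat.sig1 k) v.
apply: eq_dyadic_definable (dyadic_definable_fnn Hf' Hlam (tagnat.sig2 k)).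
by move=> D u; rewrite /g Hrep.
Qed.

Lemma dyadic_definable_layers e d (Ls : layers R S e d)
    (lam : forall D : database S, adom D -> 'rV[R]_d) :
  layers_represented dyadic_fnn Ls ->
  (forall i, dyadic_definable (fun D u => lam D u 0 i)) ->
  forall j, dyadic_definable (fun D u => layers_eval Ls (lam D) u 0 j).
Proof.
elim: Ls lam => {d} [d L|d c L Ls IH] lam /=.
  exact: dyadic_definable_layer.
move=> [HL HLs] Hlam; apply: (IH (fun D => layer_eval L (lam D))) => // i.
exact: dyadic_definable_layer.
Qed.

End Definability.

Theorem theorem14 (R : realType) (S : schema) (N : sum_dhn R S)
    (hN : dyadic_dhn N) :
  exists phi : formula S 0,
    forall (D : database S) (v : adom D), dhn_accepts N v <-> models phi v.
Proof.
have [HL [f Hf [l [r [Hl Hr Hcls]]]]] := hN.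
(* The initial embedding has no coordinates, so its definability is vacuous. *)
have Hlam0 (i : 'I_0) :
    dyadic_definable (fun (D : database S) (_ : adom D) =>
      (0 : 'rV[R]_0)%R ord0 i).
  by case: i.
have Hout := dyadic_definable_fnn Hf (dyadic_definable_layers HL Hlam0) ord0.
have [phi Hphi] := bool_definable_itv Hout Hl Hr.
by exists (phi 0) => D v; rewrite /models Hphi /dhn_accepts Hcls.
Qed.
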